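(* Let $G$ be a finite tree in which every vertex has odd degree, and let $C$ be a minimum vertex cover of $G$ that contains no leaf of $G$. Then $C$ is a minimum information dominating set of $G$, i.e., $C$ is an information dominating set of $G$ and no information dominating set of $G$ has fewer vertices.
   Context: Graphs are finite, simple and undirected. A leaf is a vertex of degree one. A binary opinion profile on $G=(V,E)$ is a vector $\mu=(\mu_v)_{v\in V}\in\{0,1\}^V$. Given $\mu$, a neighbor $w$ of a vertex $v$ is same-minded if $\mu_w=\mu_v$ and opposite-minded otherwise. The profile $\mu$ is valid (under the local majority rule) if for every vertex $v$ the number of same-minded neighbors of $v$ is greater than or equal to the number of its opposite-minded neighbors. A subset $D\subseteq V$ is an information dominating set (IDS) of $G$ if the opinions on $D$ suffice to determine those of all vertices under any valid opinion profile; equivalently, for any two different valid opinion profiles $\mu,\nu$ on $G$ there exists $v\in D$ with $\mu_v\neq\nu_v$. *)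

(* Defs.v *)
From mathcomp Require Export all_boot.

Set Implicit Arguments.
Unset Strict Implicit.
Unset Printing Implicit Defensive.

(* A simple graph is a finType of vertices with a symmetric irreflexive
   adjacency relation. *)
Definition simple_graph (V : finType) (e : rel V) : Prop :=
  symmetric e /\ irreflexive e.

Definition connected_graph (V : finType) (e : rel V) : Prop :=
  0 < #|V| /\ forall x y : V, connect e x y.

(* [cycle] and [uniq] also hold of [:: x; y] for every edge xy of a simple
   graph, hence the length bound: graph cycles have at least 3 vertices. *)
Definition acyclic_graph (V : finType) (e : rel V) : Prop :=
  forall s : seq V, cycle e s -> uniq s -> size s < 3.

Definition tree (V : finType) (e : rel V) : Prop :=
  [/\ simple_graph e, connected_graph e & acyclic_graph e].

Definition neighbors (V : finType) (e : rel V) (v : V) : {set V} :=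
  [set w | e v w].

Definition degree (V : finType) (e : rel V) (v : V) : nat := #|neighbors e v|.

Definition leaf (V : finType) (e : rel V) (v : V) : bool := degree e v == 1.

Definition vertex_cover (V : finType) (e : rel V) (C : {set V}) : Prop :=
  forall x y : V, e x y -> (x \in C) || (y \in C).

Definition profile (V : finType) := {ffun V -> bool}.

Definition same_minded (V : finType) (e : rel V) (mu : profile V) (v : V) :
  {set V} := [set w in neighbors e v | mu w == mu v].

Definition opposite_minded (V : finType) (e : rel V) (mu : profile V) (v : V) :
  {set V} := [set w in neighbors e v | mu w != mu v].

Definition valid_profile (V : finType) (e : rel V) (mu : profile V) : Prop :=
  forall v : V, #|opposite_minded e mu v| <= #|same_minded e mu v|.

Definition info_dominating (V : finType) (e : rel V) (D : {set V}) : Prop :=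
  forall mu nu : profile V, valid_profile e mu -> valid_profile e nu ->
    mu <> nu -> exists2 v : V, v \in D & mu v <> nu v.

(* Minimum cardinality, not merely minimality for inclusion. *)
Definition minimum (V : finType) (P : {set V} -> Prop) (A : {set V}) : Prop :=
  P A /\ forall B : {set V}, P B -> #|A| <= #|B|.

(* Main.v *)
(** Outside a vertex cover, a vertex sees only cover vertices, and an odd degree
    makes its opinion the strict majority of theirs; so vertex covers are
    information dominating.

    For the lower bound, call [S] a difference set if two valid profiles differ
    exactly on [S]. In a forest, [S] is a difference set as soon as neither [S]
    nor its complement induces an isolated vertex: keep the edges inside [S] and
    inside its complement monochromatic, and let the edges leaving [S] be, at
    each vertex, half monochromatic and half bichromatic up to one; flipping [S]
    exchanges the two halves. Leaf-stripping as in König's theorem partitions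
    the tree into stars with at least two vertices, one for each vertex of some
    vertex cover [K]. Each star is a difference set, so an information
    dominating set meets each of them and has at least [#|K|] vertices. *)
Require Import Defs.
From mathcomp Require Import all_boot.

(** If every vertex of [W] had two neighbours in [W], a path could be prolonged at its head for
    ever: stepping back onto the path would close a cycle. Paths of every length contradict
    finiteness. *)
Lemma forest_leaf (V : finType) (e : rel V) (W : {set V}) :
    simple_graph e -> acyclic_graph e -> W != set0 ->
  exists2 v, v \in W & {in W &, forall x y, e v x -> e v y -> x = y}.
Proof.
move=> [e_sym e_irr] e_acyc /set0Pn[x0 Wx0].
have [/exists_inP[v Wv /card_le1_eqP v_le1]|/exists_inPn deg_gt1] :=
    boolP [exists v in W, #|[set w in W | e v w]| <= 1].
  by exists v => // x y Wx Wy ex ey; apply: v_le1; rewrite inE ?Wx ?Wy.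
have other v y : v \in W -> exists z, [/\ z \in W, e v z & z != y].
  move=> /deg_gt1; rewrite -ltnNge => /card_gt1P[a [b []]].
  rewrite !inE => /andP[Wa ea] /andP[Wb eb] ab.
  have [ay|] := eqVneq a y; last by exists a.
  by exists b; rewrite -ay eq_sym.
have long n : exists x p,
    [/\ path e x p, uniq (x :: p), size p = n & {subset x :: p <= W}].
  elim: n => [|n [x [p [e_p uniq_p size_p sub_p]]]].
    by exists x0, [::]; split=> // y; rewrite inE => /eqP->.
  (* The vertex to avoid is the one after [x] on the path; for the one-vertex path the default [x]
     is harmless. *)
  have [z [Wz ez z_neq]] := other x (head x p) (sub_p x (mem_head x p)).
  exists z, (x :: p); split.
  - by rewrite /= e_sym ez.
  - rewrite cons_uniq uniq_p andbT inE negb_or.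
    have -> /= : z != x by apply: contraTneq ez => ->; rewrite e_irr.
    apply/negP => pz; case: p e_p uniq_p z_neq pz {size_p sub_p} => //= y q.
    move=> /andP[exy e_q] uniq_q z_neq; rewrite inE (negPf z_neq) /= => qz.
    case/splitPr: qz e_q uniq_q => q1 q2; rewrite cat_path => /= /and3P[e_q1 e_z _].
    rewrite -cat_rcons -[_ && _]/(uniq ([:: x, y & rcons q1 z] ++ q2)) cat_uniq.
    move=> /andP[uniq_q _].
    have cycle_q : cycle e [:: x, y & rcons q1 z].
      by rewrite /= exy !rcons_path e_q1 e_z last_rcons e_sym ez.
    by have := e_acyc _ cycle_q uniq_q; rewrite /= size_rcons.
  - by rewrite /= size_p.
  - by move=> y; rewrite inE => /predU1P[->|/sub_p].
have [x [p [_ uniq_p size_p _]]] := long #|V|.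
by have := uniq_leq_size uniq_p (fun y _ => mem_enum V y);
  rewrite -cardE /= size_p ltnn.
Qed.

(** Strip a leaf [v] with its neighbour [u]: [u] joins the cover and [v] is matched to it. Since [h]
    is a function, different cover vertices get different partners. *)
Lemma forest_cover_matching (V : finType) (e : rel V) (W : {set V}) :
    simple_graph e -> acyclic_graph e ->
  exists (K : {set V}) (h : V -> V),
    {in W &, forall x y, e x y -> (x \in K) || (y \in K)} /\
    (forall c, c \in K -> c \in W /\
       exists v, [/\ v \in W, v \notin K, e v c & h v = c]).
Proof.
move=> e_simple e_acyc; have [e_sym e_irr] := e_simple.
have [n] := ubnP #|W|; elim: n W => // n IH W ltW.
have [->|W0] := eqVneq W set0.
  by exists set0, id; split=> [x y|c]; rewrite inE.
have [v Wv v_leaf] := forest_leaf _ _ W e_simple e_acyc W0.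
have ltWv : #|W :\ v| < n.
  by move: ltW; rewrite (cardsD1 v W) Wv.
have [/exists_inP[u Wu evu]|/exists_inPn v_isol] := boolP [exists u in W, e v u].
  have ltWuv : #|W :\ v :\ u| < n.
    by apply: leq_ltn_trans ltWv; rewrite subset_leq_card ?subsetDl.
  have [K [h [K_cov K_h]]] := IH _ ltWuv.
  have vu : v != u by apply: contraTneq evu => ->; rewrite e_irr.
  have vK : v \notin K by apply/negP => /K_h[]; rewrite !inE eqxx andbF.
  exists (u |: K), (fun x => if x == v then u else h x); split.
    move=> x y Wx Wy exy; rewrite !inE.
    have [//|xu] := eqVneq x u; have [|yu] := eqVneq y u; first by rewrite orbT.
    apply: K_cov => //; rewrite !inE ?xu ?yu ?Wx ?Wy andbT /=.
      by apply: contra_neq yu => xv; apply: v_leaf => //; rewrite -xv.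
    by apply: contra_neq xu => yv; apply: v_leaf => //; rewrite -yv e_sym.
  move=> c; rewrite !inE => /predU1P[->|/K_h[]].
    by split=> //; exists v; rewrite !inE negb_or vu eqxx.
  rewrite !inE => /and3P[_ _ Wc] [w []].
  rewrite !inE => /and3P[wu wv Ww] wK ewc hw; split=> //.
  by exists w; rewrite !inE negb_or wu (negPf wv).
have [K [h [K_cov K_h]]] := IH _ ltWv.
exists K, h; split.
  move=> x y Wx Wy exy; apply: K_cov; rewrite // !inE ?Wx ?Wy andbT.
    by apply: contraTneq exy => ->; apply: v_isol.
  by apply: contraTneq exy => ->; rewrite e_sym; apply: v_isol.
move=> c /K_h[]; rewrite !inE => /andP[_ Wc] [w []].
by rewrite !inE => /andP[_ Ww] wK ewc hw; split=> //; exists w.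
Qed.

Lemma forest_star_partition (V : finType) (e : rel V) :
    simple_graph e -> acyclic_graph e -> (forall v, exists w, e v w) ->
  exists (K : {set V}) (f : V -> V),
    [/\ vertex_cover e K, {in K, forall c, f c = c} &
        forall v, exists2 w, e v w & f w = f v].
Proof.
move=> e_simple e_acyc no_isol; have [e_sym _] := e_simple.
have [K [h [K_cov K_h]]] := forest_cover_matching _ _ setT e_simple e_acyc.
have K_vc : vertex_cover e K by move=> x y; apply: K_cov; rewrite inE.
pose nbr v := xchoose (no_isol v).
(* The map [h] is meaningful only at matched vertices, hence the test. Any other vertex outside [K]
   may join any neighbour, which lies in [K] by covering. *)
pose f v := if v \in K then v else if e v (h v) then h v else nbr v.
have fK : {in K, forall c, f c = c} by move=> c Kc; rewrite /f Kc.
have f_nbr v : v \notin K -> e v (f v).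
  rewrite /f => /negPf->; case: ifP => // _; exact: (xchooseP (no_isol v)).
exists K, f; split=> // v; have [Kv|nKv] := boolP (v \in K).
  have [_ [w [_ nKw ewv hw]]] := K_h v Kv.
  by exists w; rewrite 1?e_sym // (fK v) // /f (negPf nKw) hw ewv.
exists (f v); first exact: f_nbr.
by apply: fK; have := K_vc _ _ (f_nbr v nKv); rewrite (negPf nKv).
Qed.

(* [crossing e S mu W v true] and [crossing e S mu W v false] are the
   monochromatic and bichromatic edges at [v] inside [W] across the boundary of [S]. *)
Definition crossing (V : finType) (e : rel V) (S : {set V}) (mu : profile V)
    (W : {set V}) (v : V) (b : bool) : {set V} :=
  [set w in W | [&& e v w, (w \in S) != (v \in S) & (mu w == mu v) == b]].
Arguments crossing {V}.

(** Add back a leaf [v] of [W]: its opinion affects only its edge to [u], so it can copy [u] on the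
    same side of [S], or else correct the balance at [u]. At [v] itself there is at most one edge to
    balance. *)
Lemma forest_balanced_profile (V : finType) (e : rel V) (S W : {set V}) :
    simple_graph e -> acyclic_graph e ->
  exists mu : profile V,
    {in W &, forall x y, e x y -> (x \in S) = (y \in S) -> mu x = mu y} /\
    {in W, forall v b,
      #|crossing e S mu W v b| <= #|crossing e S mu W v (~~ b)|.+1}.
Proof.
move=> e_simple e_acyc; have [e_sym e_irr] := e_simple.
have [n] := ubnP #|W|; elim: n W => // n IH W ltW.
have [->|W0] := eqVneq W set0.
  by exists [ffun=> true]; split=> [x y|v]; rewrite inE.
have [v Wv v_leaf] := forest_leaf _ _ W e_simple e_acyc W0.
have ltWv : #|W :\ v| < n by move: ltW; rewrite (cardsD1 v W) Wv.
have [mu [mu_mono mu_bal]] := IH _ ltWv.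
pose ext c : profile V := [ffun x => if x == v then c else mu x].
have crossE c x b : x \in W -> x != v -> crossing e S (ext c) W x b =
    if [&& e x v, (v \in S) != (x \in S) & (c == mu x) == b]
    then v |: crossing e S mu (W :\ v) x b else crossing e S mu (W :\ v) x b.
  move=> Wx xv; apply/setP => y.
  have [->|yv] := eqVneq y v.
    by rewrite !inE !ffunE Wv eqxx (negPf xv); case: ifP; rewrite !inE eqxx.
  by rewrite !inE !ffunE (negPf yv) (negPf xv); case: ifP; rewrite !inE (negPf yv).
have nvW x b : v \notin crossing e S mu (W :\ v) x b by rewrite !inE eqxx.
have v_bal c b : #|crossing e S (ext c) W v b| <= 1.
  apply/card_le1_eqP => x y; rewrite !inE.
  by move=> /and4P[Wx ex _ _] /and4P[Wy ey _ _]; apply: v_leaf.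
have keep c x b : x \in W -> x != v -> ~~ (e x v && ((v \in S) != (x \in S))) ->
    #|crossing e S (ext c) W x b| <= #|crossing e S (ext c) W x (~~ b)|.+1.
  move=> Wx xv ncross; rewrite !crossE // !andbA (negPf ncross) /=.
  by apply: mu_bal; rewrite !inE xv.
have [/exists_inP[u Wu evu]|/exists_inPn v_isol] := boolP [exists u in W, e v u];
    last first.
  exists (ext true); split=> [x y Wx Wy exy Sxy|x Wx b].
    rewrite !ffunE; have [xv|xv] := eqVneq x v.
      by move: (v_isol y Wy); rewrite -xv exy.
    have [yv|yv] := eqVneq y v; first by move: (v_isol x Wx); rewrite -yv e_sym exy.
    by apply: mu_mono; rewrite // !inE ?xv ?yv.
  have [->|xv] := eqVneq x v; first exact: leq_trans (v_bal _ _) _.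
  by apply: keep; rewrite // e_sym (negPf (v_isol x Wx)).
have uv : u != v by apply: contraTneq evu => ->; rewrite e_irr.
have Wu' : u \in W :\ v by rewrite !inE uv.
have only_u x : x \in W -> e v x -> x = u by move=> Wx ex; apply: v_leaf.
have mono c : ((v \in S) = (u \in S) -> c = mu u) ->
    {in W &, forall x y, e x y -> (x \in S) = (y \in S) -> ext c x = ext c y}.
  move=> c_u x y Wx Wy; rewrite !ffunE.
  have [->|xv] := eqVneq x v; have [->|yv] := eqVneq y v => //.
  - by move=> /(only_u y Wy)->.
  - by rewrite e_sym => /(only_u x Wx)-> /esym/c_u.
  - by apply: mu_mono; rewrite !inE ?xv ?yv.
have [Suv|Suv] := eqVneq (v \in S) (u \in S).
  exists (ext (mu u)); split=> [|x Wx b]; first exact: mono.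
  have [->|xv] := eqVneq x v; first exact: leq_trans (v_bal _ _) _.
  apply: keep => //; apply/negP => /andP[]; rewrite e_sym => /(only_u x Wx)->.
  by rewrite Suv eqxx.
(* The new edge joins whichever class is smaller at [u]. *)
pose X := crossing e S mu (W :\ v) u; pose m := #|X true| <= #|X false|.
exists (ext (mu u == m)); split=> [|x Wx b].
  by apply: mono => Suv'; rewrite Suv' eqxx in Suv.
have [->|xv] := eqVneq x v; first exact: leq_trans (v_bal _ _) _.
have [xu|xu] := eqVneq x u; last first.
  apply: keep => //; apply/negP => /andP[]; rewrite e_sym => /(only_u x Wx) xu'.
  by rewrite xu' eqxx in xu.
rewrite xu !crossE // e_sym evu Suv /=.
have sel d : (((mu u == m) == mu u) == d) = (m == d) by case: (mu u) m d => [] [] [].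
have := mu_bal u Wu'; rewrite !{}sel /m -/X => bal.
case: (leqP #|X true| #|X false|) (bal true) (bal false) => /= le_X bal_t bal_f;
  case: b => /=; rewrite cardsU1 nvW add1n ?ltnS; by [|exact: leqW|exact: ltnW].
Qed.

Lemma forest_difference_set (V : finType) (e : rel V) (S : {set V}) :
    simple_graph e -> acyclic_graph e ->
    (forall v, exists2 w, e v w & (w \in S) = (v \in S)) ->
  exists mu nu : profile V, [/\ valid_profile e mu, valid_profile e nu &
    forall v, (mu v != nu v) = (v \in S)].
Proof.
move=> e_simple e_acyc no_isol.
have [mu [mu_mono mu_bal]] := forest_balanced_profile _ _ S setT e_simple e_acyc.
pose nu : profile V := [ffun v => mu v (+) (v \in S)].
have mono v w : e v w -> (w \in S) = (v \in S) -> mu w = mu v.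
  by move=> ew Sw; apply/esym/mu_mono; rewrite ?inE.
(* Treats both profiles at once: [b] is the class of crossing edges of [mu] that [xi] makes
   monochromatic, [true] for [mu] and [false] for [nu]. *)
have valid (xi : profile V) b :
    (forall v w, e v w ->
      (xi w == xi v) = ((w \in S) == (v \in S)) || ((mu w == mu v) == b)) ->
    valid_profile e xi.
  move=> xiE v; have [u evu Su] := no_isol v.
  have -> : opposite_minded e xi v = crossing e S mu setT v (~~ b).
    apply/setP => w; rewrite !inE; case evw: (e v w) => //=.
    by rewrite xiE // negb_or; case: (mu w == mu v) (b) => [] [].
  apply: leq_trans (mu_bal v (in_setT v) (~~ b)) _; rewrite negbK.
  (* The neighbour [u] on the side of [v] is same-minded and not counted among the crossing edges,
     so it makes up for the possible deficit of one. *)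
  have u_new : u \notin crossing e S mu setT v b by rewrite !inE Su eqxx andbF.
  have := cardsU1 u (crossing e S mu setT v b); rewrite u_new add1n => <-.
  apply/subset_leq_card/subsetP => w; rewrite !inE.
  move=> /predU1P[->|/and4P[_ evw _ muw]]; first by rewrite evu xiE // Su eqxx.
  by rewrite evw xiE // muw orbT.
exists mu, nu; split=> [||v]; last by rewrite ffunE; case: (mu v) (v \in S) => [] [].
- apply: (valid mu true) => v w /mono muE.
  by have [/muE->|_] := eqVneq (w \in S); rewrite ?eqxx ?eqb_id.
- apply: (valid nu false) => v w /mono muE; rewrite !ffunE.
  have [Sw|] := eqVneq (w \in S); first by rewrite Sw muE ?eqxx.
  by case: (w \in S) (v \in S) (mu w) (mu v) => [] [] [] [].
Qed.

(** If two valid profiles agree on [C] but differ at [v], they agree on all neighbours of [v], so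
    same-minded and opposite-minded neighbours swap. Validity of both makes the two counts equal,
    and the degree even. *)
Lemma vertex_cover_info_dominating (V : finType) (e : rel V) (C : {set V}) :
    (forall v, odd (degree e v)) -> vertex_cover e C -> info_dominating e C.
Proof.
move=> e_odd C_cov mu nu mu_valid nu_valid mu_nu.
have [/exists_inP[v Cv /eqP]|/exists_inPn agree] :=
  boolP [exists v in C, mu v != nu v]; first by exists v.
case: mu_nu; apply/ffunP => v.
have [Cv|nCv] := boolP (v \in C); first by apply/eqP/negPn/agree.
have nbrE w : e v w -> mu w = nu w.
  by move=> /C_cov; rewrite (negPf nCv) => /agree/negPn/eqP.
have split_degree (xi : profile V) :
    degree e v = #|same_minded e xi v| + #|opposite_minded e xi v|.
  rewrite /degree -(cardsID [set w | xi w == xi v]).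
  by congr (_ + _); apply: eq_card => w; rewrite !inE // andbC.
apply/eqP; apply: contraT => neq_v.
have opp_same : opposite_minded e nu v = same_minded e mu v.
  apply/setP => w; rewrite !inE; case evw: (e v w) => //=.
  by rewrite -nbrE //; case: (mu w) (mu v) (nu v) neq_v => [] [] [].
have same_opp : same_minded e nu v = opposite_minded e mu v.
  apply/setP => w; rewrite !inE; case evw: (e v w) => //=.
  by rewrite -nbrE //; case: (mu w) (mu v) (nu v) neq_v => [] [] [].
have eq_card_v : #|same_minded e mu v| = #|opposite_minded e mu v|.
  apply/eqP; rewrite eqn_leq mu_valid andbT -opp_same -same_opp.
  exact: nu_valid.
by have := e_odd v; rewrite (split_degree mu) eq_card_v addnn odd_double.
Qed.

Theorem theorem5 (V : finType) (e : rel V) (C : {set V})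
    (e_tree : tree e)
    (e_odd : forall v : V, odd (degree e v))
    (C_min : minimum (vertex_cover e) C)
    (C_leaf : forall v : V, v \in C -> ~~ leaf e v) :
  minimum (info_dominating e) C.
Proof.
have [e_simple _ e_acyc] := e_tree; have [C_cov C_le] := C_min.
split=> [|D D_dom]; first exact: vertex_cover_info_dominating.
have no_isol v : exists w, e v w.
  by have /odd_gt0/card_gt0P[w] := e_odd v; rewrite inE; exists w.
have [K [f [K_cov fK f_nbr]]] := forest_star_partition _ _ e_simple e_acyc no_isol.
(* It suffices that [f] maps [D] onto a superset of [K], that is, [D] meets the star of each [c] in
   [K]. *)
apply: leq_trans (C_le K K_cov) (leq_trans _ (leq_imset_card f D)).
apply/subset_leq_card/subsetP => c Kc.
have S_nbr v : exists2 w, e v w & (w \in [set x | f x == c]) = (v \in [set x | f x == c]).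
  by have [w evw fw] := f_nbr v; exists w; rewrite // !inE fw.
have [mu [nu [mu_valid nu_valid diff]]] :=
  forest_difference_set _ _ _ e_simple e_acyc S_nbr.
have [|v Dv /eqP] := D_dom mu nu mu_valid nu_valid.
  by move=> eq_mu; have := diff c; rewrite eq_mu eqxx inE fK // eqxx.
by rewrite diff inE => /eqP <-; apply: imset_f.
Qed.
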